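(* Let $\mathsf{WTR}=\langle e_{\mathsf s},\boldsymbol{\alpha_1}:\delta_1,\boldsymbol{\alpha_2}:\delta_2,\dots,\boldsymbol{\alpha_{k-1}}:\delta_{k-1},\boldsymbol{\alpha_k}\rangle$ be an instance of the Weakly Timed Response problem, and assume that it is solved in the system $\mathcal R$ (the synchronous full-information system described in the context). Let $r\in\mathcal R$ be a run in which $e_{\mathsf s}$ occurs. For each $h\le k$, let $\alpha_h=\langle i_h,t_h\rangle$ be the node at which response $\boldsymbol{\alpha_h}$ is performed in $r$, and let $$\beta^k_h=\Big\langle i_h,\;t_k-\sum_{j=h}^{k-1}\delta_j\Big\rangle .$$ Then $$(\mathcal R,r)\vDash K_{\alpha_k}K_{\beta^k_{k-1}}\cdots K_{\beta^k_1}\,\mathsf{occurred}_{t_1}(e_{\mathsf s}).$$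
   Context: Model. $\mathbb P=\{1,\dots,n\}$ is a finite set of agents; time ranges over $\mathbb N$. A node is a pair $\langle i,t\rangle$ with $i\in\mathbb P$ and $t$ a time. The network is a fixed (commonly known) directed graph on $\mathbb P$ in which each channel $(i,j)$ carries a weight $max_{ij}$ (a positive integer), the upper bound on transmission time. A run $r$ is a function from times to global states; $r_i(t)$ is agent $i$'s local state at time $t$ in $r$. $\mathcal R$ is the set of all runs arising when the agents follow the full-information protocol in the following synchronous environment. (1) The environment nondeterministically chooses, at each time, an arbitrary (possibly empty) set of agents at which external input events occur and which external inputs occur there; this choice is unconstrained by other occurrences. An individual external input event is associated with a specific agent and occurs at a single node, i.e. at most once in a run. (2) Each agent has a fixed initial state and perfect recall: $r_i(t)$ is the complete time-stamped history of $i$ up to and including time $t$, including the external inputs and messages (with their senders) received at nodes $\langle i,t'\rangle$ with $t'\le t$. (3) At every node $\langle i,t\rangle$, agent $i$ sends a message containing $r_i(t)$ on every outgoing channel; any further local actions (in particular responses) at $\langle i,t\rangle$ are a deterministic function of $r_i(t)$. (4) A message sent at $\langle i,t\rangle$ on channel $(i,j)$ is delivered at some $\langle j,t'\rangle$ with $t<t'\le t+max_{ij}$; the environment chooses delivery times nondeterministically and arbitrarily within this bound. Semantics. $(\mathcal R,r)\vDash\mathsf{occurred}_t(e)$ iff event $e$ has occurred in $r$ by time $t$. $(\mathcal R,r)\vDash K_{\langle i,t\rangle}\varphi$ iff $(\mathcal R,r')\vDash\varphi$ for all $r'\in\mathcal R$ with $r_i(t)=r'_i(t)$. Responses. A response $\boldsymbol{\alpha_h}$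 is a pair $\langle i_h,a_h\rangle$ indicating a (local) action $a_h$ that agent $i_h$ is required to carry out; when it is carried out in a run, $\alpha_h=\langle i_h,t_h\rangle$ denotes the node at which $a_h$ occurs (each response occurs at most once in a run). Weakly Timed Response. An instance $\langle e_{\mathsf s},\boldsymbol{\alpha_1}:\delta_1,\dots,\boldsymbol{\alpha_{k-1}}:\delta_{k-1},\boldsymbol{\alpha_k}\rangle$ consists of an external input (nondeterministic) event $e_{\mathsf s}$ (the trigger), responses $\boldsymbol{\alpha_1},\dots,\boldsymbol{\alpha_k}$, and integers $\delta_1,\dots,\delta_{k-1}$. It is solved in $\mathcal R$ if in every run of $\mathcal R$: (a) each response $\boldsymbol{\alpha_h}$, $h=1,\dots,k$, occurs in the run iff the trigger $e_{\mathsf s}$ occurs in the run; and (b) if the responses occur at nodes $\alpha_h=\langle i_h,t_h\rangle$ for all $h\le k$, then $t_{h+1}\ge t_h+\delta_h$ for every $h=1,\dots,k-1$. *)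

(* Defs.v *)
From mathcomp Require Export all_boot all_order all_algebra.
From mathcomp Require Export classical_sets.

Set Implicit Arguments.
Unset Strict Implicit.
Unset Printing Implicit Defensive.
Import Order.TTheory GRing.Theory Num.Theory.

Local Open Scope ring_scope.

(* [maxd i j] is only meaningful when [chan i j] holds.  [owner e] is the agent
   with which the external input event [e] is associated. *)
Record model : Type := Model {
  nagents : nat;
  chan : rel 'I_nagents;
  maxd : 'I_nagents -> 'I_nagents -> nat;
  maxd_gt0 : forall i j, chan i j -> (0 < maxd i j)%N;
  event : Type;
  owner : event -> 'I_nagents;
  istate : Type;
  init : 'I_nagents -> istate
}.

Definition agent (M : model) : Type := 'I_(nagents M).

Definition node (M : model) : Type := (agent M * nat)%type.

(* The complete history of an agent.  [Round l X ms] extends the history [l] by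
   one time step, at which the set of external inputs is [X]; [ms j s] is
   [Some c] if the message with content [c] that [j] sent at time [s] is
   received at that step, and [None] otherwise.  The index [s] carries no
   information beyond [c], since [c] is the history of [j] up to time [s]. *)
Inductive lstate (M : model) : Type :=
| Start of istate M
| Round of lstate M & set (event M) & (agent M -> nat -> option (lstate M)).
Arguments Start {M} _.
Arguments Round {M} _ _ _.

(* A global state is the tuple of the local states, which already record all
   the choices of the environment: the inputs and the delivery times. *)
Definition gstate (M : model) : Type := agent M -> lstate M.

Definition run (M : model) : Type := nat -> gstate M.

(* [inp t i] is the set of external inputs that the environment supplies at
   node (i, t). *)
Definition legal_inputs (M : model)
    (inp : nat -> agent M -> set (event M)) : Prop :=
  (forall t i e, inp t i e -> i = owner e) /\
  (forall t t' i i' e, inp t i e -> inp t' i' e -> t = t').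

(* [dlv i j t] is the time at which the message that [i] sends to [j] at time
   [t] is delivered; its value is irrelevant if (i, j) is not a channel. *)
Definition legal_delivery (M : model)
    (dlv : agent M -> agent M -> nat -> nat) : Prop :=
  forall i j t, chan i j -> (t < dlv i j t <= t + maxd i j)%N.

(* The local state [r t i] includes what happens at (i, t) itself, so that even
   [r 0 i] is one step after the initial state.  By [legal_delivery] the
   messages received at time [t] were sent before [t], hence these equations
   determine [r] from [inp] and [dlv]. *)
Definition generated (M : model) (inp : nat -> agent M -> set (event M))
    (dlv : agent M -> agent M -> nat -> nat) (r : run M) : Prop :=
  forall t i,
    r t i = Round (if t is t'.+1 then r t' i else Start (init i))
                  (inp t i)
                  (fun j s => if chan j i && (dlv j i s == t)
                              then Some (r s j) else None).

(* Local actions have no effect on what is communicated, so the set of runs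
   does not depend on them. *)
Definition runs (M : model) : set (run M) :=
  [set r | exists inp dlv,
     [/\ legal_inputs inp, legal_delivery dlv & generated inp dlv r]].

Definition cur_inputs (M : model) (l : lstate M) : set (event M) :=
  if l is Round _ X _ then X else set0.

(* A formula is identified with the set of runs that satisfy it. *)
Definition occurred (M : model) (t : nat) (e : event M) : set (run M) :=
  [set r | exists s i, (s <= t)%N /\ cur_inputs (r s i) e].

Definition occurs (M : model) (r : run M) (e : event M) : Prop :=
  exists t, occurred t e r.

Definition K (M : model) (v : node M) (phi : set (run M)) : set (run M) :=
  [set r | forall r', runs r' -> r v.2 v.1 = r' v.2 v.1 -> phi r'].

(* [Kchain v m phi] is K_{v m} K_{v (m-1)} ... K_{v 1} phi. *)
Fixpoint Kchain (M : model) (v : nat -> node M) (m : nat)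
    (phi : set (run M)) : set (run M) :=
  if m is m'.+1 then K (v m) (Kchain v m' phi) else phi.

(* The set of local actions performed, as a function of the local state. *)
Definition protocol (M : model) (A : Type) : Type :=
  agent M -> lstate M -> set A.

Definition response (M : model) (A : Type) : Type := (agent M * A)%type.

Definition performed_at (M : model) (A : Type) (P : protocol M A) (r : run M)
    (al : response M A) (t : nat) : Prop :=
  P al.1 (r t al.1) al.2.

Definition at_most_once (M : model) (A : Type) (P : protocol M A)
    (al : response M A) : Prop :=
  forall r, runs r -> forall t t',
    performed_at P r al t -> performed_at P r al t' -> t = t'.

(* Only [resp h] for 1 <= h <= k and [delta h] for 1 <= h < k are relevant. *)
Record wtr (M : model) (A : Type) : Type := Wtr {
  trigger : event M;
  len : nat;
  len_gt0 : (0 < len)%N;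
  resp : nat -> response M A;
  delta : nat -> int
}.

Definition solved (M : model) (A : Type) (P : protocol M A)
    (W : wtr M A) : Prop :=
  forall r, runs r ->
    (forall h, (1 <= h <= len W)%N ->
       ((exists t, performed_at P r (resp W h) t) <-> occurs r (trigger W))) /\
    (forall t : nat -> nat,
       (forall h, (1 <= h <= len W)%N -> performed_at P r (resp W h) (t h)) ->
       forall h, (1 <= h < len W)%N ->
         (t h.+1)%:Z >= (t h)%:Z + delta W h).

Definition beta_time (M : model) (A : Type) (W : wtr M A) (t : nat -> nat)
    (h : nat) : int :=
  (t (len W))%:Z - \sum_(h <= j < len W) delta W j.

(* The absolute value only converts an integer to a [nat]: it is used where
   [beta_time] is nonnegative. *)
Definition beta (M : model) (A : Type) (W : wtr M A) (t : nat -> nat)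
    (h : nat) : node M :=
  ((resp W h).1, `|beta_time W t h|%N).

Definition alpha (M : model) (A : Type) (W : wtr M A) (t : nat -> nat)
    (h : nat) : node M :=
  ((resp W h).1, t h).

(* Main.v *)
Require Import Defs.
From mathcomp Require Import boolp.
From mathcomp Require Import zify.
Import Order.TTheory GRing.Theory Num.Theory.
Local Open Scope classical_set_scope.
Local Open Scope ring_scope.

(** External inputs do not influence which messages are sent or when they
    arrive.  Hence erasing the trigger from every history of a run yields a run
    in which the trigger never occurs, and every node whose history does not
    mention the trigger keeps its state.  So a response can only be performed at
    a node whose history mentions the trigger, and, histories being
    time-stamped, any run with the same history there has the trigger at the
    very same time [s]; in [r], this [s] is at most [t 1].  Going down the chain
    from [h = k] to [h = 1], in each run reached response [h] is performed no
    later than the time of [beta h], so the trigger stays at time [s]. *)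

Set Implicit Arguments.
Unset Strict Implicit.
Unset Printing Implicit Defensive.

Fixpoint erase (M : model) (e : event M) (l : lstate M) : lstate M :=
  match l with
  | Start x => Start x
  | Round l' X ms =>
      Round (erase e l') (X `\ e)
            (fun j s => if ms j s is Some c then Some (erase e c) else None)
  end.

Lemma runs_erase (M : model) (e : event M) (r : run M) :
  runs r -> runs (fun t i => erase e (r t i)).
Proof.
move=> [inp [dlv [[own once] del gen]]].
exists (fun t i => inp t i `\ e), dlv; split=> //.
- split=> [t i e' [] /own //|t t' i i' e' [inp_e' _] [inp'_e' _]].
  exact: once inp_e' inp'_e'.
- move=> t i; rewrite gen /=; congr Round; first by case: t.
  by apply/funext => j; apply/funext => s; case: ifP.
Qed.

Lemma occurs_erase (M : model) (e : event M) (r : run M) :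
  ~ occurs (fun t i => erase e (r t i)) e.
Proof. by move=> [t [s [i [_]]]]; case: (r s i) => //= l X ms [_]; apply. Qed.

Lemma perfect_recall (M : model) (r r' : run M) (i : agent M) (s t : nat) :
  runs r -> runs r' -> (s <= t)%N -> r t i = r' t i -> r s i = r' s i.
Proof.
move=> [inp [dlv [_ _ gen]]] [inp' [dlv' [_ _ gen']]].
elim: t => [|t IH]; first by rewrite leqn0 => /eqP->.
rewrite leq_eqVlt => /orP[/eqP-> //|s_le_t].
by rewrite gen gen' => -[eq_t _ _]; apply: IH.
Qed.

Definition occurs_at (M : model) (r : run M) (e : event M) (s : nat) : Prop :=
  exists i, cur_inputs (r s i) e.

Lemma occurs_at_inj (M : model) (r : run M) (e : event M) (s s' : nat) :
  runs r -> occurs_at r e s -> occurs_at r e s' -> s = s'.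
Proof.
move=> [inp [dlv [[_ once] _ gen]]] [i]; rewrite gen => es [i'].
by rewrite gen; apply: once es.
Qed.

(** A trace of [e] in a history common to both runs, direct or nested in messages, carries one time
    stamp, so [e] would occur at that time in both. *)
Lemma erase_id (M : model) (e : event M) (r r' : run M) (t : nat) (i : agent M) :
    runs r -> runs r' ->
    (forall s, (s <= t)%N -> occurs_at r e s -> ~ occurs_at r' e s) ->
  r t i = r' t i -> erase e (r t i) = r t i.
Proof.
move=> [inp [dlv [_ del gen]]] [inp' [dlv' [_ _ gen']]].
elim/ltn_ind: t i => t IH i noe eq_rt.
have IHs s j : (s < t)%N -> r s j = r' s j -> erase e (r s j) = r s j.
  move=> s_lt_t; apply: IH => // s' s'_le_s.
  by apply: noe; apply: leq_trans s'_le_s (ltnW s_lt_t).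
have eX : ~ inp t i e.
  by move=> inpe; apply: (noe t) => //; exists i; last rewrite -eq_rt; rewrite gen.
move: eq_rt; rewrite {1}gen gen' => -[eq_past _ eq_ms].
rewrite gen /= not_setD1 //; congr Round.
  by case: t IHs eq_past {IH noe eX eq_ms} => //= t IHs eq_past; apply: IHs.
apply/funext => j; apply/funext => s.
have := congr1 (fun f => f j s) eq_ms => /=.
(* A message received in [r] is received in [r'] under the same index [s], so the sender's states at
   [s] agree; delivery takes positive time, so [s < t]. *)
case: ifP => // /andP[ch /eqP dt]; case: ifP => // _ [eq_s].
by rewrite IHs // -dt; case/andP: (del _ _ s ch).
Qed.

(** Otherwise the response would also be performed in the erased run. Taking [r' := r] bounds the
    trigger's time by that of the response. *)
Lemma performed_common_trigger (M : model) (A : Type) (P : protocol M A)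
    (W : wtr M A) (r r' : run M) (h u : nat) :
    solved P W -> runs r -> runs r' -> (1 <= h <= len W)%N ->
    performed_at P r (resp W h) u -> r u (resp W h).1 = r' u (resp W h).1 ->
  exists2 s, (s <= u)%N & occurs_at r (trigger W) s /\ occurs_at r' (trigger W) s.
Proof.
move=> sol Rr Rr' hk perf eq_u; apply: contrapT => nocommon.
have er : erase (trigger W) (r u (resp W h).1) = r u (resp W h).1.
  apply: (@erase_id _ _ r r') => // s s_le_u es es'.
  by apply: nocommon; exists s.
have [/(_ h hk)[+ _] _] := sol _ (@runs_erase _ (trigger W) _ Rr).
have perf' : performed_at P (fun t i => erase (trigger W) (r t i)) (resp W h) u.
  by rewrite /performed_at er.
by move=> /(_ (ex_intro _ u perf'))/occurs_erase.
Qed.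

Lemma solved_times (M : model) (A : Type) (P : protocol M A) (W : wtr M A)
    (r : run M) :
    solved P W -> runs r -> occurs r (trigger W) ->
  exists t : nat -> nat,
    (forall h, (1 <= h <= len W)%N -> performed_at P r (resp W h) (t h)) /\
    (forall h, (1 <= h < len W)%N -> (t h)%:Z + delta W h <= (t h.+1)%:Z).
Proof.
move=> sol Rr occ; have [iff_occ timed] := sol _ Rr.
have ex h : exists u, (1 <= h <= len W)%N -> performed_at P r (resp W h) u.
  have [hk|/negP nhk] := boolP (1 <= h <= len W)%N; last by exists 0%N.
  by have [u pu] := (iff_occ h hk).2 occ; exists u.
have [t tP] := choice ex.
by exists t; split=> //; apply: timed.
Qed.

Lemma beta_timeS (M : model) (A : Type) (W : wtr M A) (t : nat -> nat) (h : nat) :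
  (h < len W)%N -> beta_time W t h = beta_time W t h.+1 - delta W h.
Proof. by move=> hk; rewrite /beta_time big_ltn // opprD addrCA addrC. Qed.

Lemma beta_time_len (M : model) (A : Type) (W : wtr M A) (t : nat -> nat) :
  beta_time W t (len W) = (t (len W))%:Z.
Proof. by rewrite /beta_time big_geq // subr0. Qed.

Lemma performed_le_beta (M : model) (A : Type) (P : protocol M A) (W : wtr M A)
    (r : run M) (t : nat -> nat) :
    solved P W -> runs r ->
    (forall h, (1 <= h <= len W)%N -> performed_at P r (resp W h) (t h)) ->
  forall h, (1 <= h <= len W)%N -> (t h)%:Z <= beta_time W t h.
Proof.
(* Downward induction from [len W], on the distance [len W - h]. *)
move=> sol Rr perf h /andP[h_gt0 hk]; rewrite -(subKn hk).
move: (len W - h)%N (leq_sub2l (len W) h_gt0) => d; elim: d => [|d IH] d_lt.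
  by rewrite subn0 beta_time_len.
have {}IH := IH (ltnW d_lt).
have dk : (1 <= len W - d.+1 < len W)%N by have := len_gt0 W; lia.
have [_ /(_ t perf _ dk)] := sol _ Rr.
rewrite beta_timeS; last by case/andP: dk.
have -> : ((len W - d.+1).+1 = len W - d)%N by lia.
by lia.
Qed.

(** The nodes [beta W t] stay fixed while [r] and [u] vary, since each [K] moves to a run with its
    own response times. *)
Lemma Kchain_occurred (M : model) (A : Type) (P : protocol M A) (W : wtr M A)
    (t : nat -> nat) (s : nat) :
    (forall h, (1 <= h <= len W)%N -> at_most_once P (resp W h)) ->
    solved P W -> (s <= t 1%N)%N ->
  forall m (r : run M) (u : nat), (1 <= m <= len W)%N -> runs r ->
    performed_at P r (resp W m) u -> u%:Z <= beta_time W t m ->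
    occurs_at r (trigger W) s ->
  Kchain (beta W t) m (occurred (t 1%N) (trigger W)) r.
Proof.
move=> once sol s_le; elim=> [//|m IH] r u mk Rr perf u_le es r' Rr' eq_beta.
(* As [0 <= u <= beta_time W t m.+1], the absolute value in [beta] is harmless and agreement passes
   back to time [u]. *)
have {}eq_beta : r u (resp W m.+1).1 = r' u (resp W m.+1).1.
  by apply: perfect_recall eq_beta => //=; lia.
have perf' : performed_at P r' (resp W m.+1) u by rewrite /performed_at -eq_beta.
have [s' _ [es' es'r']] := performed_common_trigger sol Rr Rr' mk perf eq_beta.
have {es'}ss' := occurs_at_inj Rr es' es; rewrite {s'}ss' in es'r'.
case: m IH mk perf perf' u_le eq_beta => [|m] IH mk perf perf' u_le eq_beta.
  by case: es'r' => i ei; exists s, i.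
have occ : occurs r' (trigger W) by case: es'r' => i ei; exists s, s, i.
have [t' [t'P timed]] := solved_times sol Rr' occ.
(* Uniqueness ties the times [t'] of [r'] to [u], so the bound on [u] yields the one on
   [t' m.+1]. *)
have t'u : t' m.+2 = u by apply: once perf' => //; apply: t'P.
have mk' : (1 <= m.+1 < len W)%N by lia.
apply: (IH r' (t' m.+1)) => //; first by lia.
- by apply: t'P; lia.
- by rewrite beta_timeS //; have := timed _ mk'; rewrite t'u; lia.
Qed.

Theorem theorem6 (M : model) (A : Type) (P : protocol M A) (W : wtr M A)
  (Honce : forall h, (1 <= h <= len W)%N -> at_most_once P (resp W h))
  (Hsolved : solved P W)
  (r : run M) (Hr : runs r) (Hocc : occurs r (trigger W))
  (t : nat -> nat)
  (Ht : forall h, (1 <= h <= len W)%N -> performed_at P r (resp W h) (t h)) :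
  (forall h, (1 <= h < len W)%N -> 0 <= beta_time W t h) /\
  K (alpha W t (len W))
    (Kchain (beta W t) (len W).-1 (occurred (t 1%N) (trigger W))) r.
Proof.
have l_gt0 := len_gt0 W.
have le_beta := performed_le_beta Hsolved Hr Ht.
split=> [h hk|].
  by apply: le_trans (le_beta h _) => //; lia.
have one_k : (1 <= 1 <= len W)%N by [].
have [s s_le [es _]] :=
  performed_common_trigger Hsolved Hr Hr one_k (Ht _ one_k) erefl.
have kk : (1 <= len W <= len W)%N by rewrite l_gt0 /=.
have := Kchain_occurred Honce Hsolved s_le kk Hr (Ht _ kk) (le_beta _ kk) es.
(* The sum in [beta_time] is empty at [len W], so the outer [K] is the top link of the chain. *)
have -> : alpha W t (len W) = beta W t (len W).
  by rewrite /alpha /beta beta_time_len.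
by rewrite -{1}(prednK l_gt0) /= prednK.
Qed.
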